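(* Let $s$ and $t$ be relatively prime positive integers, and let $X$ denote the size of a partition chosen uniformly at random from the set of $(s,t)$-core partitions. Then the fifth moment of $X$ about its mean is $$\mathbf{E}\big[(X-\mathbf{E}[X])^5\big]=\frac{1}{95800320}\, s\,t\,(t-1)(s-1)(s+t+1)(s+t)\,P(s,t),$$ where $$\begin{aligned}P(s,t)={}&46s^6t^3+138s^5t^4+138s^4t^5+46s^3t^6-211s^6t^2-633s^5t^3-844s^4t^4-633s^3t^5-211s^2t^6\\&+333s^6t+999s^5t^2+1665s^4t^3+1665s^3t^4+999s^2t^5+333st^6\\&-180s^6-540s^5t-1283s^4t^2-1666s^3t^3-1283s^2t^4-540st^5-180t^6\\&+420s^4t+840s^3t^2+840s^2t^3+420st^4-180s^4-360s^3t-540s^2t^2-360st^3-180t^4\\&+327s^2t+327st^2-180s^2-180st-180t^2-3780.\end{aligned}$$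
   Context: A partition is a non-increasing finite sequence of positive integers $\lambda=(\lambda_1,\dots,\lambda_k)$, $k\ge 0$ (the empty partition is allowed); its size is $\lambda_1+\dots+\lambda_k$. Its Ferrers diagram consists of the cells $(i,j)$ with $1\le i\le k$, $1\le j\le\lambda_i$. The hook length of cell $(i,j)$ is $\lambda_i-j+\lambda'_j-i+1$, where $\lambda'$ is the conjugate partition ($\lambda'_j$ = number of $i$ with $\lambda_i\ge j$). A partition is an $s$-core if no cell has hook length equal to $s$, and an $(s,t)$-core partition if it is simultaneously an $s$-core and a $t$-core. For coprime $s,t$ the set of $(s,t)$-core partitions is finite, and it is given the uniform probability distribution. *)

(* Defs.v *)
From mathcomp Require Import all_boot all_order all_algebra finmap.
From mathcomp Require Import classical_sets cardinality fsbigop.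
Set Implicit Arguments.
Unset Strict Implicit.
Unset Printing Implicit Defensive.
Local Open Scope classical_set_scope.
Local Open Scope ring_scope.

Definition is_partition (la : seq nat) : bool :=
  sorted geq la && all (ltn 0) la.

(* Rows and columns are numbered from 1. *)
Definition part (la : seq nat) (i : nat) : nat := nth 0%N la i.-1.

Definition conj_part (la : seq nat) (j : nat) : nat :=
  count (fun x => j <= x)%N la.

Definition is_cell (la : seq nat) (i j : nat) : bool :=
  (1 <= i <= size la)%N && (1 <= j <= part la i)%N.

(* On cells neither truncated subtraction underflows. *)
Definition hook_length (la : seq nat) (i j : nat) : nat :=
  ((part la i - j) + (conj_part la j - i) + 1)%N.

Definition is_core (s : nat) (la : seq nat) : Prop :=
  forall i j, is_cell la i j -> hook_length la i j <> s.

Definition st_cores (s t : nat) : set (seq nat) :=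
  [set la | is_partition la /\ is_core s la /\ is_core t la].

(* Expectation under the uniform distribution on a nonempty finite set A; for
   infinite A the cardinal, and hence the quotient, defaults to 0. *)
Definition uniform_E (T : choiceType) (A : set T) (f : T -> rat) : rat :=
  (\sum_(x \in A) f x) / (#|` fset_set A|)%:R.

Definition moment_about_mean (T : choiceType) (A : set T) (X : T -> rat)
    (k : nat) : rat :=
  uniform_E A (fun x => (X x - uniform_E A X) ^+ k).

Definition partition_size (la : seq nat) : rat := (sumn la)%:R.

Definition P5 (s t : rat) : rat :=
    46 * s^+6 * t^+3 + 138 * s^+5 * t^+4 + 138 * s^+4 * t^+5 + 46 * s^+3 * t^+6
  - 211 * s^+6 * t^+2 - 633 * s^+5 * t^+3 - 844 * s^+4 * t^+4
  - 633 * s^+3 * t^+5 - 211 * s^+2 * t^+6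
  + 333 * s^+6 * t + 999 * s^+5 * t^+2 + 1665 * s^+4 * t^+3
  + 1665 * s^+3 * t^+4 + 999 * s^+2 * t^+5 + 333 * s * t^+6
  - 180 * s^+6 - 540 * s^+5 * t - 1283 * s^+4 * t^+2 - 1666 * s^+3 * t^+3
  - 1283 * s^+2 * t^+4 - 540 * s * t^+5 - 180 * t^+6
  + 420 * s^+4 * t + 840 * s^+3 * t^+2 + 840 * s^+2 * t^+3 + 420 * s * t^+4
  - 180 * s^+4 - 360 * s^+3 * t - 540 * s^+2 * t^+2 - 360 * s * t^+3
  - 180 * t^+4
  + 327 * s^+2 * t + 327 * s * t^+2 - 180 * s^+2 - 180 * s * t - 180 * t^+2
  - 3780.

(* Main.v *)
From Stdlib Require Import BinInt.
Require Import Defs.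
From mathcomp Require Import all_boot all_order all_algebra finmap.
From mathcomp Require Import classical_sets cardinality fsbigop.
From mathcomp Require Import zify ssrZ ring.
Set Implicit Arguments.
Unset Strict Implicit.
Unset Printing Implicit Defensive.
Import Order.TTheory GRing.Theory Num.Theory.

(* Walk along the residues 0, t, 2t, ... modulo s and record, in each class, the
   least number u_i that is not a first-column hook length. An (s,t)-core thus
   becomes a composition w of t into s parts with
   u_i = i t - s (w_0 + ... + w_(i-1)) >= 0 for all i, and its size is half the
   variance of the u_i minus (s^2 - 1) / 24. By the cycle lemma every composition
   has exactly one rotation with all u_i >= 0, and rotations only translate the
   u_i, so the size of a random core is distributed as that function of a uniform
   composition.
   For fixed s the k-th central moment is then a polynomial in t of degree at
   most 2k, invariant under t -> -s-t (the reciprocity w_i -> -1-w_i maps u_i to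
   -u_i). The moment is also symmetric in s and t, so by strong induction on s it
   is known at the t < s coprime to s; six such values and their reflections
   determine a polynomial of degree 10. The few s with fewer than six such t are
   settled by computing the moment for t < 6. *)

(** * First-column hook lengths *)

(** The first-column hook lengths in increasing order, also called the beta-set: rows are indexed
    from the bottom, so the leg of the first cell of row [j] has length [j]. *)
Definition beta (la : seq nat) : seq nat :=
  mkseq (fun j => nth 0 (rev la) j + j) (size la).
Definition of_beta (b : seq nat) : seq nat :=
  rev (mkseq (fun j => nth 0 b j - j) (size b)).

Lemma sorted_ltn_geq_index b i : sorted ltn b -> i < size b -> i <= nth 0 b i.
Proof.
move=> sb; elim: i => // i IHi lti; have := IHi (ltnW lti).
by have := elimT (sortedP 0) sb i lti => /=; lia.
Qed.

Lemma sorted_ltn_gt_index b i :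
  sorted ltn b -> all (ltn 0) b -> i < size b -> i < nth 0 b i.
Proof.
move=> sb b0; elim: i => [|i IHi] lti; first exact: (elimT (all_nthP 0) b0).
by have := IHi (ltnW lti); have := elimT (sortedP 0) sb i lti => /=; lia.
Qed.

Lemma is_partition_rev la :
  is_partition la = sorted leq (rev la) && all (ltn 0) (rev la).
Proof. by rewrite /is_partition rev_sorted all_rev. Qed.

Lemma nth_beta la j : j < size la -> nth 0 (beta la) j = nth 0 (rev la) j + j.
Proof. by move=> lt; rewrite nth_mkseq. Qed.

Lemma size_beta la : size (beta la) = size la.
Proof. exact: size_mkseq. Qed.

Lemma beta_sorted la : is_partition la -> sorted ltn (beta la).
Proof.
rewrite is_partition_rev => /andP[sl _]; apply/(sortedP 0) => i.
rewrite size_beta => lti; rewrite !nth_beta //; last exact: ltnW.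
by have := elimT (sortedP 0) sl i; rewrite size_rev => /(_ lti) /=; lia.
Qed.

Lemma beta_gt0 la : is_partition la -> all (ltn 0) (beta la).
Proof.
rewrite is_partition_rev => /andP[_ /all_nthP p0]; apply/(all_nthP 0) => i.
rewrite size_beta => lti; rewrite nth_beta //=.
by have := p0 0 i; rewrite size_rev => /(_ lti) /=; lia.
Qed.

Lemma of_betaK la : of_beta (beta la) = la.
Proof.
rewrite /of_beta size_beta -[RHS]revK; congr rev.
apply: (@eq_from_nth _ 0) => [|i]; rewrite size_mkseq ?size_rev // => lti.
by rewrite nth_mkseq // nth_beta // addnK.
Qed.

Lemma of_beta_partition b :
  sorted ltn b -> all (ltn 0) b -> is_partition (of_beta b).
Proof.
move=> sb b0; rewrite is_partition_rev revK; apply/andP; split.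
  apply/(sortedP 0) => i; rewrite size_mkseq => lti.
  rewrite !nth_mkseq //; last exact: ltnW.
  by have := elimT (sortedP 0) sb i lti => /=; lia.
apply/(all_nthP 0) => i; rewrite size_mkseq => lti; rewrite nth_mkseq //=.
by have := sorted_ltn_gt_index sb b0 lti; lia.
Qed.

Lemma beta_of_beta b : sorted ltn b -> beta (of_beta b) = b.
Proof.
move=> sb; rewrite /beta revK size_rev size_mkseq.
apply: (@eq_from_nth _ 0) => [|i]; rewrite size_mkseq // => lti.
by rewrite !nth_mkseq // subnK // sorted_ltn_geq_index.
Qed.

Lemma count_leq_find j m : sorted leq m ->
  count (leq j) m = size m - find (leq j) m.
Proof.
elim: m => //= x m IHm sm; have sm' := path_sorted sm; case: ifP => jx.
  rewrite subn0 add1n; congr _.+1; apply/eqP; rewrite -all_count.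
  apply/allP => y ym; have /allP/(_ y ym) := order_path_min leq_trans sm.
  exact: leq_trans.
by rewrite add0n subSS IHm.
Qed.

Lemma find_leq_nth j m x : sorted leq m -> find (leq j) m <= x -> x < size m ->
  j <= nth 0 m x.
Proof.
move=> sm fx xm; have hs : has (leq j) m by rewrite has_find (leq_ltn_trans fx).
apply: leq_trans (nth_find 0 hs) _.
by apply: (sorted_leq_nth leq_trans leqnn 0 sm) => //; rewrite inE // -has_find.
Qed.

(** With rows indexed from the bottom, the rows too short to meet column [j] form a prefix whose
    length is [find]; the leg consists of the rows between this prefix and row [x]. *)
Lemma hook_length_find la x j : is_partition la -> x < size la ->
  0 < j <= nth 0 (rev la) x ->
  find (leq j) (rev la) <= x /\
  hook_length la (size la - x) j =
    nth 0 (rev la) x - j + (x - find (leq j) (rev la)) + 1.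
Proof.
rewrite is_partition_rev => /andP[sl _] xl /andP[j0 jx].
have fx : find (leq j) (rev la) <= x.
  by rewrite leqNgt; apply/negP => /(before_find 0) /=; rewrite jx.
split=> //; rewrite /hook_length /part /conj_part.
rewrite -[in count _ la](revK la) count_rev count_leq_find // size_rev.
rewrite nth_rev // (_ : (size la - x).-1 = size la - x.+1); last by lia.
by congr (_ + _ + 1); lia.
Qed.

(* A cell of column j in the row of hook length b has hook length b - e, where
   e = j - 1 + #{rows shorter than j}; these e enumerate the complement of
   [beta la]. *)
Lemma is_coreP s la : 0 < s -> is_partition la ->
  is_core s la <->
  {in beta la, forall b, s <= b -> b - s \in beta la}.
Proof.
move=> s0 pla; have := pla; rewrite is_partition_rev => /andP[sl _].
split=> [core b /(nthP 0)[x]|closed i j].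
  rewrite size_beta => xl <-; rewrite nth_beta // => sb.
  apply: contraT => eB; exfalso; set e := _ - s in eB.
  have sB := beta_sorted pla.
  have sB' : sorted leq (beta la) by apply: sub_sorted sB => ? ?; exact: ltnW.
  (* [q] counts the elements of [beta la] below the missing value [e]. Column [e - q + 1] turns out
     to have exactly [q] rows shorter than it, so its cell in row [x] has hook length [s]. *)
  pose q := find (leq e) (beta la).
  have qx : q <= x.
    rewrite leqNgt; apply/negP => /(before_find 0).
    by rewrite nth_beta //= /e; lia.
  have qe : q <= e.
    case Eq : q => [//|y]; have yq : y < q by rewrite Eq.
    have := before_find 0 yq; have := @sorted_ltn_geq_index _ y sB.
    by rewrite size_beta /=; lia.
  have Bq : e < nth 0 (rev la) q + q.
    have ql : q < size la by lia.
    have : e <= nth 0 (beta la) q.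
      by apply: find_leq_nth => //; rewrite size_beta.
    rewrite leq_eqVlt nth_beta // => /orP[/eqP eE|//]; case/negP: eB.
    by rewrite eE -nth_beta // mem_nth // size_beta.
  have fq : find (leq (e - q).+1) (rev la) = q.
    apply/eqP; rewrite eqn_leq; apply/andP; split.
      rewrite leqNgt; apply/negP => /(before_find 0) /=; lia.
    rewrite leqNgt; apply/negP => fltq.
    case Eq : q fltq => [//|y] fltq; have yq : y < q by rewrite Eq.
    have yl : y < size la by lia.
    have := before_find 0 yq; rewrite nth_beta //=.
    by have := find_leq_nth sl (fltq : _ <= y); rewrite size_rev => /(_ yl); lia.
  have jx : 0 < (e - q).+1 <= nth 0 (rev la) x.
    by rewrite /=; apply: (find_leq_nth sl); rewrite ?fq ?size_rev.
  have [_ hE] := hook_length_find pla xl jx.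
  apply: (core (size la - x) (e - q).+1); last first.
    by rewrite hE fq; rewrite /e in qe Bq *; lia.
  rewrite /is_cell /part (_ : (size la - x).-1 = size la - x.+1); last by lia.
  by rewrite -nth_rev // jx; lia.
move=> /andP[/andP[i1 il] /andP[j1 jp]].
have xl : size la - i < size la by lia.
have jx : 0 < j <= nth 0 (rev la) (size la - i).
  rewrite nth_rev // j1; move: jp; rewrite /part; congr (_ <= nth _ _ _); lia.
have [fx hE] := hook_length_find pla xl jx; move: hE; rewrite subKn // => hE.
set q := find _ _ in fx hE; set x := size la - i in xl jx fx hE; move=> hs.
have bB : nth 0 (rev la) x + x \in beta la.
  by rewrite -nth_beta // mem_nth // size_beta.
have sb : s <= nth 0 (rev la) x + x by lia.
have /(nthP 0)[y] := closed _ bB sb; rewrite size_beta.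
have -> : nth 0 (rev la) x + x - s = j.-1 + q by lia.
move=> yl; rewrite nth_beta // => yE.
(* Rows below [q] are shorter than [j] and give values less than [j - 1 + q]; the other rows give
   values of at least [j + q]. Hence [j - 1 + q] is never attained. *)
have [yq|qy] := ltnP y q.
  by have := before_find 0 yq => /=; lia.
by have := find_leq_nth sl qy; rewrite size_rev => /(_ yl); lia.
Qed.

Lemma modn_mulr_inj s t i j : coprime s t -> i < s -> j < s ->
  i * t = j * t %[mod s] -> i = j.
Proof.
move=> co; wlog le : i j / i <= j.
  move=> IH li lj e; have [le|le] := leqP i j; first exact: IH.
  by apply/esym/IH => //; apply: ltnW.
move=> li lj /esym/eqP; rewrite eqn_mod_dvd ?leq_mul2r ?le ?orbT //.
rewrite -mulnBl Gauss_dvdl // => d; apply/eqP; rewrite eqn_leq le /= -subn_eq0.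
by move: d; case: (j - i) (leq_subr i j) => // m mj /(dvdn_leq (ltn0Sn m)); lia.
Qed.

(** * Sums over compositions *)

Local Open Scope ring_scope.

(** Zero parts are allowed. An explicit list, built on the first part, serves both inductions over
    sums and direct computation. *)
Fixpoint comps (s t : nat) : seq (seq nat) :=
  if s is s'.+1 then [seq z :: w | z <- iota 0 t.+1, w <- comps s' (t - z)]
  else if t is 0%N then [:: [::]] else [::].

Lemma mem_comps s t (w : seq nat) :
  (w \in comps s t) = (size w == s) && (sumn w == t).
Proof.
elim: s t w => [|s IHs] t w.
  by case: t => [|t] /=; case: w => [|z w] //=; rewrite inE.
apply/allpairsPdep/idP => [[z [w' []]]|].
  rewrite mem_iota IHs => zt /andP[/eqP sw /eqP tw] ->.
  by rewrite /= sw tw eqxx /=; lia.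
case: w => [|z w] //= /andP[sw /eqP tw]; exists z, w; split=> //.
  by rewrite -[_ :: _]/(iota 0 t.+1) mem_iota; lia.
by rewrite IHs -eqSS sw /=; lia.
Qed.

Lemma comps_uniq s t : uniq (comps s t).
Proof.
elim: s t => [|s IHs] t; first by case: t.
change (uniq [seq z :: w | z <- iota 0 t.+1, w <- comps s (t - z)]).
apply: allpairs_uniq_dep => [|z _|]; first exact: iota_uniq; first exact: IHs.
by move=> [z w] [z' w'] /= _ _ [-> ->].
Qed.

Lemma big_comps (V : nmodType) s t (f : seq nat -> V) :
  \sum_(w <- comps s.+1 t) f w =
  \sum_(z < t.+1) \sum_(w <- comps s (t - z)) f ((z : nat) :: w).
Proof.
pose F (z : nat) := \sum_(w <- comps s (t - z)) f (z :: w).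
rewrite -(big_mkord xpredT F) /index_iota subn0.
rewrite -[comps s.+1 t]/[seq z :: w | z <- iota 0 t.+1, w <- comps s (t - z)].
by rewrite big_allpairs_dep.
Qed.

(** Both sides are the coefficient of x^t in (1-x)^-(a+1) (1-x)^-(b+1). The double induction uses
    Pascal's rule only. *)
Lemma sum_bin_binS t a b :
  (\sum_(z < t.+1) 'C(z + a, a) * 'C(t - z + b, b) =
   'C(t + a + b + 1, a + b + 1))%N.
Proof.
elim: b t => [|b IHb] t.
  elim: t => [|t IHt]; first by rewrite big_ord1 subnn !add0n !addn0 !binn.
  have -> : ('C(t.+1 + a + 0 + 1, a + 0 + 1) =
      'C(t + a + 0 + 1, a + 0 + 1) + 'C(t.+1 + a, a))%N.
    by rewrite !addn0 !addn1 binS addSn.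
  rewrite -IHt big_ord_recr /= bin0 muln1; congr (_ + _)%N.
  by apply: eq_bigr => i _; rewrite !bin0.
elim: t => [|t IHt].
  by rewrite big_ord1 subnn !add0n !binn.
have -> : (t.+1 + a + b.+1 + 1 = (t + a + b.+1 + 1).+1)%N by lia.
have -> : (a + b.+1 + 1 = (a + b + 1).+1)%N by lia.
rewrite binS.
have -> : (t + a + b.+1 + 1 = t.+1 + a + b + 1)%N by lia.
rewrite -IHb.
have -> : (t.+1 + a + b + 1 = t + a + b.+1 + 1)%N by lia.
have -> : ((a + b + 1).+1 = a + b.+1 + 1)%N by lia.
rewrite -IHt !(big_ord_recr t.+1) /= subnn !add0n !binn.
rewrite addnA; congr (_ + _)%N; rewrite -big_split; apply: eq_bigr => i _ /=.
rewrite -mulnDr; congr (_ * _)%N.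
have lei := ltn_ord i.
have -> : (t.+1 - i + b.+1 = (t - i + b.+1).+1)%N by lia.
by rewrite binS; congr (_ + 'C(_, _))%N; lia.
Qed.

(** Coefficient of x^t in x^a (1-x)^-(a+1) times x^b (1-x)^-(n+b+1). Only a <= z <= t - b
    contributes, and shifting by [a] reduces to [sum_bin_binS]. *)
Lemma sum_bin_bin t n a b :
  (\sum_(z < t.+1) 'C(z, a) * 'C(t - z + n, n + b) =
   'C(t + n + 1, n + a + b + 1))%N.
Proof.
have [ltab|] := ltnP t (a + b).
  rewrite bin_small; last by lia.
  rewrite big1 // => z _; have := ltn_ord z => ltz.
  have [ltza|leaz] := ltnP z a; first by rewrite bin_small.
  by rewrite [X in (_ * X)%N]bin_small ?muln0 //; lia.
move=> leabt; rewrite -(subnKC leabt); set c := (t - (a + b))%N.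
have -> : (n + a + b + 1 = a + (n + b) + 1)%N by lia.
have -> : (a + b + c + n + 1 = c + a + (n + b) + 1)%N by lia.
rewrite -sum_bin_binS.
rewrite -(big_mkord xpredT (fun z => 'C(z, a) * 'C(a + b + c - z + n, n + b))%N).
rewrite (@big_cat_nat _ _ _ a) //=; last by lia.
rewrite [X in (X + _)%N]big_nat_cond big1 ?add0n; last first.
  by move=> z; rewrite andbT => /andP[_ lt]; rewrite bin_small.
rewrite (@big_cat_nat _ _ _ (a + c.+1)) //=; try lia.
rewrite [X in (_ + X)%N]big_nat_cond [X in (_ + X)%N]big1 ?addn0; last first.
  move=> z; rewrite andbT => /andP[le1 lt2].
  by rewrite [X in (_ * X)%N]bin_small ?muln0 //; lia.
set F := (F in \sum_(a <= i < _) F i).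
rewrite -[X in (\sum_(X <= _ < _) _)%N]add0n big_addn addKn big_mkord /F.
apply: eq_bigr => z _; have lez := ltn_ord z; congr (_ * 'C(_, _))%N; lia.
Qed.

(** * Binomial weights and reciprocity of sums over compositions *)

Definition binw (n : nat) (a : nat -> nat) (w : seq nat) : nat :=
  (\prod_(i < n) 'C(nth 0 w i, a i))%N.
(* Up to sign, [binw] at -1 - w. *)
Definition mbinw (n : nat) (a : nat -> nat) (w : seq nat) : nat :=
  (\prod_(i < n) 'C(nth 0 w i + a i, a i))%N.

Lemma sum_ord_recl n (a : nat -> nat) :
  (\sum_(i < n.+1) a i = a 0 + \sum_(i < n) a i.+1)%N.
Proof. by rewrite big_ord_recl. Qed.

Lemma sum_binw n a t :
  (\sum_(w <- comps n.+1 t) binw n.+1 a w =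
   'C(t + n, n + \sum_(i < n.+1) a i))%N.
Proof.
elim: n a t => [|n IHn] a t.
  rewrite (big_comps _ _ (binw 1 a)) big_ord_recr /= subnn big_seq1.
  rewrite /binw !big_ord1 /= addn0 big1 ?add0n // => z _.
  have : (0 < t - z)%N by have := ltn_ord z; lia.
  by case: (t - z)%N => [//|k _]; rewrite big_nil.
rewrite (big_comps _ _ (binw n.+2 a)).
under eq_bigr => z _.
  under eq_bigr => w _ do rewrite /binw big_ord_recl /=.
  rewrite -big_distrr /=.
  rewrite (IHn (fun i => a i.+1) (t - z)%N).
  over.
rewrite sum_bin_bin sum_ord_recl; congr 'C(_, _); lia.
Qed.

Lemma sum_mbinw n a t :
  (\sum_(w <- comps n.+1 t) mbinw n.+1 a w =
   'C(t + n + \sum_(i < n.+1) a i, n + \sum_(i < n.+1) a i))%N.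
Proof.
elim: n a t => [|n IHn] a t.
  rewrite (big_comps _ _ (mbinw 1 a)) big_ord_recr /= subnn big_seq1.
  rewrite /mbinw !big_ord1 /= addn0 big1 ?add0n // => z _.
  have : (0 < t - z)%N by have := ltn_ord z; lia.
  by case: (t - z)%N => [//|k _]; rewrite big_nil.
rewrite (big_comps _ _ (mbinw n.+2 a)).
under eq_bigr => z _.
  under eq_bigr => w _ do rewrite /mbinw big_ord_recl /=.
  rewrite -big_distrr /=.
  rewrite (IHn (fun i => a i.+1) (t - z)%N).
  rewrite -addnA.
  over.
rewrite sum_bin_binS sum_ord_recl; congr 'C(_, _); lia.
Qed.

Definition incr (a : nat -> nat) (i : nat) : nat -> nat :=
  fun j => (a j + (j == i))%N.

Lemma sum_incr n a (i : 'I_n) :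
  (\sum_(j < n) incr a i j = (\sum_(j < n) a j).+1)%N.
Proof.
rewrite /incr big_split /= -addn1; congr (_ + _)%N.
by rewrite (bigD1 i) //= eqxx big1 // => j ne; rewrite (negPf (_ : (j : nat) != i)).
Qed.

(** Multiplication by a part, expressed in the binomial basis, where every sum over compositions has
    a closed form. *)
Lemma binw_incr n a w (i : 'I_n) :
  (nth 0 w i * binw n a w =
   (a i).+1 * binw n (incr a i) w + a i * binw n a w)%N.
Proof.
have D F : (\prod_(j < n) F j = F i * \prod_(j < n | j != i) F j)%N.
  by rewrite (bigD1 i).
rewrite /binw !D /incr eqxx addn1.
under [X in (_ = _ * (_ * X) + _)%N]eq_bigr => j ne.
  rewrite (negPf (_ : (j : nat) != i)) // addn0; over.
have E : (nth 0 w i * 'C(nth 0 w i, a i) =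
    (a i).+1 * 'C(nth 0 w i, (a i).+1) + a i * 'C(nth 0 w i, a i))%N.
  rewrite mul_bin_left; have [lt|le] := ltnP (nth 0 w i) (a i).
    by rewrite bin_small ?muln0.
  by rewrite -mulnDl subnK.
by rewrite mulnA E mulnDl !mulnA.
Qed.

(** The image of [binw_incr] under w_i -> -1 - w_i, with the signs cleared. *)
Lemma mbinw_incr n a w (i : 'I_n) :
  ((nth 0 w i).+1 * mbinw n a w + a i * mbinw n a w =
   (a i).+1 * mbinw n (incr a i) w)%N.
Proof.
have D F : (\prod_(j < n) F j = F i * \prod_(j < n | j != i) F j)%N.
  by rewrite (bigD1 i).
rewrite /mbinw !D /incr eqxx addn1.
under [X in (_ = _ * (_ * X))%N]eq_bigr => j ne.
  rewrite (negPf (_ : (j : nat) != i)) // addn0; over.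
by rewrite !mulnA -mulnDl -mulnDl addnS -mul_bin_diag addSn.
Qed.

(* [g] is the reciprocal of [f], i.e. what [f] becomes under the substitution
   w_i -> -1 - w_i, t -> -n.+1 - t. *)
Definition recip_poly (n d : nat) (f g : nat -> seq nat -> rat) : Prop :=
  forall a : nat -> nat, let A := (\sum_(i < n.+1) a i)%N in
  exists2 p : {poly rat}, (size p <= d.+1)%N & forall t,
    \sum_(w <- comps n.+1 t) (binw n.+1 a w)%:R * f t w =
      'C(t + n, n + A)%:R * p.[t%:R] /\
    \sum_(w <- comps n.+1 t) (mbinw n.+1 a w)%:R * g t w =
      'C(t + n + A, n + A)%:R * p.[- (n.+1 + t)%:R].

Lemma recip_poly1 n : recip_poly n 0 (fun _ _ => 1) (fun _ _ => 1).
Proof.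
move=> a; exists 1; rewrite ?size_poly1 // => t; rewrite !hornerC !mulr1.
rewrite -sum_binw -sum_mbinw !natr_sum.
by split; apply: eq_bigr => w _; rewrite mulr1.
Qed.

Lemma eq_recip_poly n d f g f' g' :
  (forall t w, w \in comps n.+1 t -> f t w = f' t w) ->
  (forall t w, w \in comps n.+1 t -> g t w = g' t w) ->
  recip_poly n d f g -> recip_poly n d f' g'.
Proof.
move=> ef eg fg a; have [p sp pE] := fg a; exists p => // t.
have [<- <-] := pE t.
by split; rewrite !big_seq; apply: eq_bigr => w wC; rewrite ?ef ?eg.
Qed.

Lemma recip_polyD n d f g f' g' :
  recip_poly n d f g -> recip_poly n d f' g' ->
  recip_poly n d (fun t w => f t w + f' t w) (fun t w => g t w + g' t w).
Proof.
move=> fg fg' a; have [p sp pE] := fg a; have [p' sp' pE'] := fg' a.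
exists (p + p') => [|t].
  by rewrite (leq_trans (size_polyD _ _)) // geq_max sp.
have [e1 e2] := pE t; have [e1' e2'] := pE' t.
rewrite !hornerD !mulrDr -e1 -e2 -e1' -e2'.
by split; rewrite -big_split; apply: eq_bigr => w _; rewrite mulrDr.
Qed.

Lemma recip_polyZ n d c f g : recip_poly n d f g ->
  recip_poly n d (fun t w => c * f t w) (fun t w => c * g t w).
Proof.
move=> fg a; have [p sp pE] := fg a.
exists (c *: p) => [|t]; first by rewrite (leq_trans (size_scale_leq _ _)).
have [e1 e2] := pE t; rewrite !hornerZ !(mulrCA _ c) -e1 -e2.
by split; rewrite big_distrr; apply: eq_bigr => w _; rewrite mulrCA.
Qed.

Lemma recip_polyW n d d' f g : (d <= d')%N ->
  recip_poly n d f g -> recip_poly n d' f g.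
Proof.
move=> le fg a; have [p sp pE] := fg a; exists p => //.
by rewrite (leq_trans sp).
Qed.

Lemma recip_poly_sum (I : Type) (r : seq I) n d
    (f g : I -> nat -> seq nat -> rat) :
  (forall i, recip_poly n d (f i) (g i)) ->
  recip_poly n d (fun t w => \sum_(i <- r) f i t w)
                 (fun t w => \sum_(i <- r) g i t w).
Proof.
move=> fg; elim: r => [|i r IHr].
  apply: (@eq_recip_poly _ _ (fun _ _ => 0 * 1) (fun _ _ => 0 * 1))
    => [t w _|t w _|].
  - by rewrite big_nil mul0r.
  - by rewrite big_nil mul0r.
  - by apply: recip_polyZ; apply: recip_polyW (recip_poly1 n).
apply: eq_recip_poly (recip_polyD (fg i) IHr) => t w _; by rewrite big_cons.
Qed.

Lemma recip_poly_mult n d f g : recip_poly n d f g ->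
  recip_poly n d.+1 (fun t w => t%:R * f t w)
                    (fun t w => - (n.+1 + t)%:R * g t w).
Proof.
move=> fg a; have [p sp pE] := fg a; exists ('X * p) => [|t].
  by rewrite (leq_trans (size_polyMleq _ _)) // size_polyX.
have [e1 e2] := pE t.
rewrite !hornerM !hornerX !(mulrCA 'C(_, _)%:R) -e1 -e2 !big_distrr.
by split; apply: eq_bigr => w _; rewrite mulrCA.
Qed.

(** A factor w_i turns the weight [a] into a combination of [a] and [incr a i], which is why
    [recip_poly] ranges over all weights. The closed sums for the two weights differ by the factor
    (t - A) / (n + A + 1), linear in t, so the degree grows by one. *)
Lemma recip_poly_nth n d f g (i : 'I_n.+1) : recip_poly n d f g ->
  recip_poly n d.+1 (fun t w => (nth 0%N w i)%:R * f t w)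
                    (fun t w => - (nth 0%N w i).+1%:R * g t w).
Proof.
move=> fg a; set A := (\sum_(j < n.+1) a j)%N.
have [p sp pE] := fg a; have [q sq] := fg (incr a i).
rewrite sum_incr -/A => qE.
have nz k : k.+1%:R != 0 :> rat by rewrite pnatr_eq0.
pose c : rat := (a i).+1%:R / (n + A).+1%:R.
exists (c *: (('X - A%:R%:P) * q) + (a i)%:R *: p) => [|t].
  rewrite (leq_trans (size_polyD _ _)) // geq_max.
  rewrite !(leq_trans (size_scale_leq _ _)) //; last exact: leqW.
  by rewrite (leq_trans (size_polyMleq _ _)) // size_XsubC.
have [e1 e2] := pE t; have [e1' e2'] := qE t.
rewrite !(hornerD, hornerZ, hornerM, hornerX, hornerN, hornerC).
split.
  transitivity ((a i).+1%:R * ('C(t + n, n + A.+1)%:R * q.[t%:R])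
      + (a i)%:R * ('C(t + n, n + A)%:R * p.[t%:R])).
    rewrite -e1 -e1' !big_distrr -big_split; apply: eq_bigr => w _ /=.
    rewrite mulrA [_ * (nth _ _ _)%:R]mulrC -natrM.
    by rewrite binw_incr natrD !natrM; ring.
  have E : 'C(t + n, n + A.+1)%:R =
      'C(t + n, n + A)%:R * (t%:R - A%:R) / (n + A).+1%:R :> rat.
    apply: (canRL (mulfK (nz _))); rewrite -natrM addnS mulnC mul_bin_left.
    have [lt|le] := ltnP (t + n)%N (n + A).
      by rewrite bin_small // muln0 mul0r.
    by rewrite natrM -natrB ?subnDr; [rewrite addnC subnDl mulrC| lia].
  by rewrite E /c; ring.
transitivity (- (a i).+1%:R
      * ('C(t + n + A.+1, n + A.+1)%:R * q.[- (n.+1 + t)%:R])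
    + (a i)%:R * ('C(t + n + A, n + A)%:R * p.[- (n.+1 + t)%:R])).
  rewrite -e2 -e2' !big_distrr -big_split; apply: eq_bigr => w _ /=.
  have := congr1 (fun k => k%:R : rat) (mbinw_incr a w i).
  by rewrite natrD !natrM => E; rewrite [in RHS]mulrA [in RHS]mulNr -E; ring.
(* The factor [n.+1 + t + A] is minus the value of X - A at [- (n.+1 + t)]; this sign cancels the
   one in front of [(a i).+1]. *)
have E : 'C(t + n + A.+1, n + A.+1)%:R =
    'C(t + n + A, n + A)%:R * (n.+1 + t + A)%:R / (n + A).+1%:R :> rat.
  apply: (canRL (mulfK (nz _))); rewrite -!natrM !addnS.
  rewrite mulnC -mul_bin_diag /= mulnC.
  by congr (_ * _)%:R; lia.
by rewrite E /c [(n.+1 + t + A)%:R]natrD; ring.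
Qed.

(** * Heights and the size attached to a composition *)

Definition height (s t : nat) (w : seq nat) (i : nat) : rat :=
  (i * t)%:R - (s * sumn (take i w))%:R.

(** The double sum is 2 s^2 times the variance of the heights; written with differences it is
    visibly invariant under translation. *)
Definition comp_size (s t : nat) (w : seq nat) : rat :=
  (\sum_(i < s) \sum_(j < s) (height s t w i - height s t w j) ^+ 2)
    / (4 * s%:R ^+ 2) - (s%:R ^+ 2 - 1) / 24.

(** Armstrong's formula for the average size. It is fixed in advance as the centre and shown to be
    the mean only at the end, by the same interpolation as the fifth moment. *)
Definition mean_size (s t : nat) : rat :=
  (s%:R - 1) * (t%:R - 1) * (s%:R + t%:R + 1) / 24.

Lemma sumn_take w i : (i <= size w)%N ->
  sumn (take i w) = (\sum_(j < i) nth 0%N w j)%N.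
Proof.
move=> le; rewrite sumnE (big_nth 0%N) size_takel // big_mkord.
by apply: eq_bigr => j _; rewrite nth_take.
Qed.

(** Under the substitution, i t - s (w_0 + ... + w_(i-1)) becomes -i (s + t) + s (i + w_0 + ... +
    w_(i-1)), which is minus the height. *)
Lemma recip_poly_height n d f g (i : 'I_n.+1) : recip_poly n d f g ->
  recip_poly n d.+1 (fun t w => height n.+1 t w i * f t w)
                    (fun t w => - height n.+1 t w i * g t w).
Proof.
move=> fg.
have ij (j : 'I_i) : (j < n.+1)%N by have := ltn_ord j; have := ltn_ord i; lia.
have H1 := recip_polyZ i%:R (recip_poly_mult fg).
have H2 := recip_polyZ (- n.+1%:R)
  (recip_poly_sum (index_enum 'I_i)
    (fun j => recip_poly_nth (Ordinal (ij j)) fg)).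
have hE t w : w \in comps n.+1 t ->
    height n.+1 t w i = i%:R * t%:R - n.+1%:R * \sum_(j < i) (nth 0%N w j)%:R.
  rewrite mem_comps => /andP[/eqP sw _].
  by rewrite /height sumn_take ?sw ?(ltnW (ltn_ord i)) // !natrM natr_sum.
apply: eq_recip_poly (recip_polyD H1 H2) => t w wC /=; rewrite hE //.
  by rewrite -big_distrl /=; ring.
rewrite -big_distrl sumrN /=.
under eq_bigr => j _ do rewrite -natr1.
rewrite big_split /= sumr_const card_ord natrD; ring.
Qed.

(** Heights enter through squares of differences, so their signs cancel, and (t - 1)(s + t + 1) is
    fixed by t -> -s - t. *)
Lemma recip_poly_comp_size n d f g : recip_poly n d f g ->
  recip_poly n d.+2 (fun t w => (comp_size n.+1 t w - mean_size n.+1 t) * f t w)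
                    (fun t w => (comp_size n.+1 t w - mean_size n.+1 t) * g t w).
Proof.
move=> fg.
have D e f' g' (i j : 'I_n.+1) : recip_poly n e f' g' ->
    recip_poly n e.+1
      (fun t w => (height n.+1 t w i - height n.+1 t w j) * f' t w)
      (fun t w => - (height n.+1 t w i - height n.+1 t w j) * g' t w).
  move=> fg'; have Hi := recip_poly_height i fg'.
  have Hj := recip_polyZ (-1) (recip_poly_height j fg').
  by apply: eq_recip_poly (recip_polyD Hi Hj) => t w _ /=; ring.
have H1 := recip_polyZ (4 * n.+1%:R ^+ 2)^-1
  (recip_poly_sum (index_enum 'I_n.+1) (fun i =>
   recip_poly_sum (index_enum 'I_n.+1) (fun j =>
   D _ _ _ i j (D _ _ _ i j fg)))).
have H2 := recip_poly_mult fg.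
(* [H3], [H4] and [H5] carry the t^2, t and constant terms of [- mean_size]; [H5] also takes the
   constant of [comp_size]. *)
have H3 := recip_polyZ (- (n%:R / 24)) (recip_poly_mult H2).
have H4 := recip_polyZ (- (n.+1%:R * n%:R / 24)) (recip_polyW (leqnSn _) H2).
have H5 := recip_polyZ (n.+2%:R * n%:R / 24 - (n.+1%:R ^+ 2 - 1) / 24)
  (recip_polyW (leqW (leqnSn _)) fg).
have sE (F : 'I_n.+1 -> 'I_n.+1 -> rat) x :
    \sum_i \sum_j F i j * x = (\sum_i \sum_j F i j) * x.
  by rewrite big_distrl; apply: eq_bigr => i _; rewrite big_distrl.
have H := recip_polyD (recip_polyD H1 H3) (recip_polyD H4 H5).
apply: eq_recip_poly H => t w wC /=.
  under eq_bigr => i _ do under eq_bigr => j _ do rewrite mulrA -expr2.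
  by rewrite sE /comp_size /mean_size -!natr1; ring.
under eq_bigr => i _ do under eq_bigr => j _ do rewrite mulrA mulrNN -expr2.
by rewrite sE /comp_size /mean_size !natrD -!natr1; ring.
Qed.

(** The summand is its own reciprocal, so for the zero weight the two sums of [recip_poly] coincide;
    cancelling the nonzero binomial gives the reflection. *)
Lemma central_sum_poly n k : exists2 p : {poly rat}, (size p <= k.*2.+1)%N &
  forall t,
    \sum_(w <- comps n.+1 t) (comp_size n.+1 t w - mean_size n.+1 t) ^+ k
      = 'C(t + n, n)%:R * p.[t%:R] /\ p.[- (n.+1 + t)%:R] = p.[t%:R].
Proof.
have H : recip_poly n k.*2
    (fun t w => (comp_size n.+1 t w - mean_size n.+1 t) ^+ k)
    (fun t w => (comp_size n.+1 t w - mean_size n.+1 t) ^+ k).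
  elim: k => [|k IHk]; first exact: recip_poly1.
  by apply: eq_recip_poly (recip_poly_comp_size IHk) => t w _; rewrite -exprS.
have [p sp pE] := H (fun _ => 0%N); exists p => // t.
have A0 : (\sum_(i < n.+1) 0 = 0)%N by rewrite big1.
have [] := pE t; rewrite !A0 !addn0.
have E1 w : binw n.+1 (fun _ => 0%N) w = 1%N.
  by rewrite /binw big1 // => i _; rewrite bin0.
have E2 w : mbinw n.+1 (fun _ => 0%N) w = 1%N.
  by rewrite /mbinw big1 // => i _; rewrite bin0.
under eq_bigr do rewrite E1 mul1r.
under [X in _ -> X = _ -> _]eq_bigr do rewrite E2 mul1r.
move=> e1 e2; split=> //; move: e2; rewrite e1 => /mulfI ->//.
by rewrite pnatr_eq0 -lt0n bin_gt0; lia.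
Qed.

(** * The cycle lemma *)

Definition good (s t : nat) (w : seq nat) : bool :=
  [forall i : 'I_s, s * sumn (take i w) <= i * t]%N.

(** Rotating by one shifts the indices and subtracts the height at 1. The index [s] that appears
    wraps around, since the heights at [s] and at 0 agree. *)
Lemma comp_size_rot1 s t (w : seq nat) : w \in comps s t ->
  comp_size s t (rot 1 w) = comp_size s t w.
Proof.
case: s => [|n]; rewrite mem_comps => /andP[].
  by rewrite size_eq0 => /eqP->.
case: w => [//|z w] /eqP [sw] /eqP tw.
have hE (i : 'I_n.+1) : height n.+1 t (rot 1 (z :: w)) i =
    height n.+1 t (z :: w) i.+1 - height n.+1 t (z :: w) 1.
  rewrite /height rot1_cons -cats1 takel_cat ?sw -1?ltnS // /= take0 /=.
  rewrite !natrM !natrD -!natr1; ring.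
have hn : height n.+1 t (z :: w) n.+1 = height n.+1 t (z :: w) 0.
  by rewrite /height take_oversize ?take0 /= ?sw // -tw mul0n muln0 !subrr.
have shift (F : nat -> rat) : F n.+1 = F 0%N ->
    \sum_(i < n.+1) F i.+1 = \sum_(i < n.+1) F i.
  by move=> Fn; rewrite [LHS]big_ord_recr [RHS]big_ord_recl /= Fn addrC.
have D (a b c : rat) : a - c - (b - c) = a - b by ring.
rewrite /comp_size; congr (_ / _ - _).
under eq_bigr => i _ do under eq_bigr => j _ do rewrite !hE D.
set h := height _ _ _ in hn *.
under eq_bigr => i _ do rewrite (shift (fun j => (h i.+1 - h j) ^+ 2)) ?hn //.
by rewrite (shift (fun i => \sum_(j < n.+1) (h i - h j) ^+ 2)) ?hn.
Qed.

Lemma rot_comps s t (w : seq nat) k :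
  (rot k w \in comps s t) = (w \in comps s t).
Proof.
rewrite !mem_comps size_rot; congr (_ && (_ == _)).
by rewrite /rot sumn_cat addnC -sumn_cat cat_take_drop.
Qed.

Lemma comp_size_rot s t (w : seq nat) k : (k <= size w)%N -> w \in comps s t ->
  comp_size s t (rot k w) = comp_size s t w.
Proof.
elim: k => [|k IHk] kw wC; first by rewrite rot0.
by rewrite -add1n rotD // comp_size_rot1 ?rot_comps // IHk // ltnW.
Qed.

Lemma height_rot s t (w : seq nat) k i : w \in comps s t ->
  (k < s)%N -> (i < s)%N ->
  height s t (rot k w) i = height s t w ((i + k) %% s) - height s t w k.
Proof.
rewrite mem_comps => /andP[/eqP sw /eqP tw] ks is_.
have kw : (k <= size w)%N by rewrite sw ltnW.
have tk := congr1 sumn (cat_take_drop k w); rewrite sumn_cat tw in tk.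
rewrite /rot /height; have [lt|le] := ltnP (i + k) s.
  rewrite modn_small // takel_cat ?size_drop; last by lia.
  have -> : take (i + k) w = take k w ++ take i (drop k w).
    by rewrite addnC takeD.
  by rewrite sumn_cat !natrM !natrD; ring.
have -> : ((i + k) %% s = i + k - s)%N.
  by rewrite -{1}(subnK le) modnDr modn_small //; lia.
rewrite take_cat size_drop sw ltnNge leq_subLR addnC le /= sumn_cat.
rewrite (_ : (i - (s - k) = i + k - s)%N); last by lia.
rewrite take_takel; last by lia.
rewrite -tk.
set a := sumn _; set b := sumn _; set c := sumn _; set m := (i + k - s)%N.
rewrite !natrM; rewrite !natrD.
have -> : i%:R = m%:R + s%:R - k%:R :> rat by rewrite /m natrB // natrD; ring.
ring.
Qed.

Lemma height_inj s t w i j : coprime s t -> (i < s)%N -> (j < s)%N ->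
  height s t w i = height s t w j -> i = j.
Proof.
move=> co lti ltj /eqP; rewrite subr_eq addrAC eq_sym subr_eq -!natrD eqr_nat.
move=> /eqP/(congr1 (modn^~ s)).
rewrite /= !(addnC (_ * t)) ![(s * _)%N]mulnC !modnMDl => e.
exact: modn_mulr_inj co lti ltj (esym e).
Qed.

Lemma goodP s t w :
  reflect (forall i, (i < s)%N -> 0 <= height s t w i) (good s t w).
Proof.
apply: (iffP forallP) => [H i lti|H i].
  by rewrite subr_ge0 ler_nat; apply: (H (Ordinal lti)).
by have := H i (ltn_ord i); rewrite subr_ge0 ler_nat.
Qed.

(* The good rotation starts at the lowest point, which is unique
   since the heights are distinct modulo [s]. *)
Lemma unique_good_rot s t (w : seq nat) : coprime s t -> (0 < s)%N ->
  w \in comps s t ->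
  (\sum_(k < s) good s t (rot k w) = 1)%N.
Proof.
move=> co; case: s co => [//|n] co _ wC.
pose h (k : 'I_n.+1) := height n.+1 t w k.
case: (@arg_minP _ _ _ ord0 xpredT h) => // k _ kmin.
rewrite (bigD1 k) //= big1.
  suff -> : good n.+1 t (rot k w) by [].
  apply/goodP => i lti; rewrite height_rot // subr_ge0.
  by apply: (kmin (Ordinal (ltn_pmod (i + k) (ltn0Sn n)))).
move=> j jk; case: (boolP (good _ _ _)) => // /goodP H; case/eqP: jk.
apply/val_inj; apply: (height_inj co (ltn_ord j) (ltn_ord k) (w := w)).
apply/le_anti; rewrite kmin // andbT -subr_ge0.
(* At this index the rotation by [j] has height [h k - h j], so goodness yields [h j <= h k]. *)
have lt : ((k + (n.+1 - j)) %% n.+1 < n.+1)%N by rewrite ltn_pmod.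
have := H _ lt.
rewrite height_rot // modnDml -addnA subnK ?(ltnW (ltn_ord j)) //.
by rewrite modnDr modn_small.
Qed.

(** Double counting: insert the number of good rotations, which is 1, exchange the sums, and use
    that each rotation permutes the compositions and keeps [comp_size]. *)
Lemma sum_comps_good s t (g : rat -> rat) : coprime s t -> (0 < s)%N ->
  \sum_(w <- comps s t) g (comp_size s t w) =
  s%:R * \sum_(w <- comps s t | good s t w) g (comp_size s t w).
Proof.
move=> co s0.
transitivity (\sum_(w <- comps s t) \sum_(k < s)
    (good s t (rot k w))%:R * g (comp_size s t (rot k w))).
  rewrite !big_seq; apply: eq_bigr => w wC.
  have /eqP sw : size w == s by move: wC; rewrite mem_comps => /andP[].
  under eq_bigr => k _ do rewrite comp_size_rot // ?sw ?(ltnW (ltn_ord k)) //.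
  by rewrite -big_distrl /= -natr_sum unique_good_rot // mul1r.
rewrite exchange_big /=.
under eq_bigr => k _.
  rewrite -(big_map (rot k) xpredT
    (fun w => (good s t w)%:R * g (comp_size s t w))).
  rewrite (perm_big (comps s t)); last first.
    apply: uniq_perm; rewrite ?comps_uniq ?map_inj_uniq ?comps_uniq //.
      exact: rot_inj.
    move=> w; rewrite -[w in LHS](rotrK k) mem_map; last exact: rot_inj.
    exact: rot_comps.
  over.
rewrite sumr_const card_ord -[LHS]mulr_natl [in RHS]big_mkcond /=.
congr (_ * _).
by apply: eq_bigr => w _; case: good; rewrite ?mul1r ?mul0r.
Qed.

(** * Cores and compositions *)

Local Open Scope nat_scope.

(** The height as a natural number; for a good composition the subtraction does not truncate. *)
Definition nheight (s t : nat) (w : seq nat) (i : nat) : nat :=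
  i * t - s * sumn (take i w).

(** An [s]-abacus with flush runners: in the residue class of the [i]-th height, the beads are the
    numbers below that height. *)
Definition comp_beads (s t : nat) (w : seq nat) : seq nat :=
  [seq nheight s t w i %% s + s * j | i <- iota 0 s,
                                      j <- iota 0 (nheight s t w i %/ s)].

Definition core_of_comp (s t : nat) (w : seq nat) : seq nat :=
  of_beta (sort leq (comp_beads s t w)).

Lemma nheightK s t w i : good s t w -> i < s ->
  nheight s t w i + s * sumn (take i w) = i * t.
Proof.
by move=> /forallP gw lti; rewrite subnK //; apply: (gw (Ordinal lti)).
Qed.

Lemma nheight_mod s t w i : good s t w -> i < s ->
  nheight s t w i = i * t %[mod s].
Proof.
by move=> gw lti; rewrite -(nheightK gw lti) addnC [s * _]mulnC modnMDl.
Qed.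

Lemma modn_mulr_ord_inj s t (s0 : 0 < s) : coprime s t ->
  injective (fun i : 'I_s => Ordinal (ltn_pmod (i * t) s0)).
Proof.
move=> co i j /(congr1 val) /= e.
by apply/val_inj/(modn_mulr_inj co (ltn_ord i) (ltn_ord j)).
Qed.

Lemma modn_mulr_surj s t x : coprime s t -> 0 < s ->
  exists2 i, i < s & x = i * t %[mod s].
Proof.
move=> co s0; have [g _ gK] := injF_bij (@modn_mulr_ord_inj s t s0 co).
exists (g (Ordinal (ltn_pmod x s0))) => //.
by have /(congr1 val) /= -> := gK (Ordinal (ltn_pmod x s0)).
Qed.

Lemma mem_comp_beads s t w x : 0 < s ->
  reflect (exists2 i, i < s &
            (x == nheight s t w i %[mod s]) && (x < nheight s t w i))
          (x \in comp_beads s t w).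
Proof.
move=> s0; apply: (iffP allpairsPdep)
  => [[i [j []]]|[i lti /andP[/eqP xE xlt]]].
  rewrite !mem_iota /= !add0n => lti ltj ->; exists i => //.
  rewrite [s * j]mulnC addnC modnMDl modn_mod eqxx /=.
  rewrite [X in _ < X](divn_eq _ s) ltn_add2r ltn_mul2r s0 /=; lia.
exists i, (x %/ s); split; rewrite ?mem_iota //=.
  move: xlt; rewrite {1}(divn_eq x s) {1}(divn_eq (nheight s t w i) s) xE.
  by rewrite ltn_add2r ltn_mul2r => /andP[].
by rewrite -xE {1}(divn_eq x s) mulnC addnC.
Qed.

Lemma comp_beads_nheight s t w x i : coprime s t -> good s t w -> i < s ->
  x = i * t %[mod s] -> (x \in comp_beads s t w) = (x < nheight s t w i).
Proof.
move=> co gw lti xE; have s0 : 0 < s by lia.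
apply/(mem_comp_beads _ _ _ s0)/idP => [[j ltj /andP[/eqP e xlt]]|xlt].
  suff -> : i = j by [].
  by apply: (modn_mulr_inj co) => //; rewrite -(nheight_mod gw ltj) -e xE.
by exists i => //; rewrite xlt andbT nheight_mod // xE.
Qed.

Lemma comp_beads_uniq s t w : coprime s t -> good s t w ->
  uniq (comp_beads s t w).
Proof.
move=> co gw; apply: allpairs_uniq_dep => [|i _|]; rewrite ?iota_uniq //.
move=> [i j] [i' j'] /allpairsPdep[i1 [j1 [+ _]]] + /allpairsPdep[i2 [j2 [+ _]]] +.
rewrite !mem_iota !add0n /= => l1 [-> ->] l2 [-> ->] /= e.
have s0 : 0 < s by lia.
have ei : i1 = i2.
  apply: (modn_mulr_inj co) => //.
  have := congr1 (modn^~ s) e.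
  rewrite /= !(addnC (_ %% s)) ![s * _]mulnC !modnMDl !modn_mod.
  by rewrite !nheight_mod.
rewrite -ei in e *; congr (existT _ _ _); move/eqP: e.
by rewrite eqn_add2l eqn_mul2l; case: (s) s0 => // k _ /= /eqP.
Qed.

Lemma sort_beads_sorted s t w : coprime s t -> good s t w ->
  sorted ltn (sort leq (comp_beads s t w)).
Proof.
move=> co gw; rewrite ltn_sorted_uniq_leq sort_uniq comp_beads_uniq //.
exact/sort_sorted/leq_total.
Qed.

(** Parts are nonnegative, so the heights rise by at most [t] per step; this makes the bead set
    closed under subtracting [t]. *)
Lemma nheightS_le s t w i : good s t w -> w \in comps s t -> i.+1 < s ->
  nheight s t w i.+1 <= nheight s t w i + t.
Proof.
rewrite mem_comps => gw /andP[/eqP sw _] lti.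
have := nheightK gw lti; have := nheightK gw (ltnW lti).
rewrite (take_nth 0) ?sw ?(ltnW lti) // -cats1 sumn_cat; nia.
Qed.

Lemma core_of_comp_core s t w : coprime s t -> 0 < s -> 0 < t ->
  w \in comps s t -> good s t w -> st_cores s t (core_of_comp s t w).
Proof.
move=> co s0 t0 wC gw; have sb := sort_beads_sorted co gw.
have b0 : all (ltn 0) (sort leq (comp_beads s t w)).
  (* Zero is no bead: its residue class is that of index 0, whose height is 0. *)
  apply/allP => x; rewrite mem_sort; case: x => // /(mem_comp_beads _ _ _ s0).
  case=> i lti /andP[/eqP e lt]; suff i0 : 0 = i.
    by rewrite -i0 /nheight mul0n in lt.
  by apply: (modn_mulr_inj co) => //; rewrite mul0n e nheight_mod.
have pla := of_beta_partition sb b0.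
split=> //; split; apply/is_coreP => //;
  rewrite /core_of_comp beta_of_beta // => b; rewrite !mem_sort.
  move=> /(mem_comp_beads _ _ _ s0)[i lti /andP[/eqP e lt]] sleb.
  apply/(mem_comp_beads _ _ _ s0); exists i => //.
  rewrite -e -{2}(subnK sleb) modnDr eqxx /=.
  by lia.
(* The class of index 0 has no beads. Subtracting [t] moves a bead of class [i.+1] into class
   [i]. *)
move=> /(mem_comp_beads _ _ _ s0)[[|i] lti /andP[/eqP e lt]] tleb.
  by rewrite /nheight mul0n in lt.
have li := ltnW lti.
rewrite (comp_beads_nheight co gw li).
  by have := nheightS_le gw wC lti; lia.
apply/eqP; rewrite -(eqn_modDr t) subnK // e nheight_mod //.
by apply/eqP; congr (_ %% _); lia.
Qed.

(** The beads determine the heights as thresholds in the residue classes, hence the partial sums,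
    hence the parts. *)
Lemma core_of_comp_inj s t w w' : coprime s t -> 0 < s ->
  w \in comps s t -> good s t w -> w' \in comps s t -> good s t w' ->
  core_of_comp s t w = core_of_comp s t w' -> w = w'.
Proof.
move=> co s0 wC gw wC' gw' /(congr1 beta).
rewrite !beta_of_beta ?sort_beads_sorted // => e.
have eB x : (x \in comp_beads s t w) = (x \in comp_beads s t w').
  by rewrite -[LHS](mem_sort leq) -[RHS](mem_sort leq) e.
have eh i : i < s -> nheight s t w i = nheight s t w' i.
  move=> lti; apply/eqP; rewrite eqn_leq; apply/andP; split.
    rewrite leqNgt -(comp_beads_nheight co gw lti) ?nheight_mod // eB.
    by rewrite (comp_beads_nheight co gw' lti) ?nheight_mod // ltnn.
  rewrite leqNgt -(comp_beads_nheight co gw' lti) ?nheight_mod // -eB.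
  by rewrite (comp_beads_nheight co gw lti) ?nheight_mod // ltnn.
move: wC wC'; rewrite !mem_comps.
move=> /andP[/eqP sw /eqP tw] /andP[/eqP sw' /eqP tw'].
have et i : i <= s -> sumn (take i w) = sumn (take i w').
  rewrite leq_eqVlt => /orP[/eqP->|lti].
    by rewrite !take_oversize ?sw ?sw' // tw tw'.
  have := nheightK gw lti; have := nheightK gw' lti.
  rewrite (eh _ lti) => <- /addnI /eqP.
  by rewrite eqn_mul2l eqn0Ngt s0 => /eqP.
apply: (@eq_from_nth _ 0); rewrite sw ?sw' // => i lti.
have := et _ lti; rewrite !(take_nth 0) ?sw ?sw' // -!cats1 !sumn_cat.
rewrite et ?(ltnW lti) //= !addn0.
exact: addnI.
Qed.

(** Let [H i] be the least non-bead in the class of [i * t]. Closure under subtracting [s] makes the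
    beads of the class exactly the numbers below [H i]; closure under [t] gives [H i.+1 <= H i + t],
    and the slack divided by [s] is the part w_i. *)
Lemma core_of_comp_surj s t la : coprime s t -> 0 < s -> 0 < t ->
  st_cores s t la ->
  exists w, [/\ w \in comps s t, good s t w & core_of_comp s t w = la].
Proof.
move=> co s0 t0 [pla [/(is_coreP s0 pla) cs /(is_coreP t0 pla) ct]].
have exn r : exists n, r + s * n \notin beta la.
  (* The resulting number exceeds the sum of [beta la], so it cannot be a member. *)
  exists (sumn (beta la)).+1; apply/negP => rB.
  have := perm_sumn (perm_to_rem rB); rewrite /=; nia.
pose n r := ex_minn (exn r).
pose H i := i * t %% s + s * n (i * t %% s).
have Hmod i : H i = i * t %[mod s] by rewrite /H addnC mulnC modnMDl modn_mod.
have HB i x : x = i * t %[mod s] -> (x \in beta la) = (x < H i).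
  move=> xE; rewrite /H /n; case: ex_minnP => m mB mmin.
  rewrite -xE in mB mmin *.
  have xE' : x = x %% s + s * (x %/ s) by rewrite {1}(divn_eq x s) addnC mulnC.
  apply/idP/idP => [xB|]; last first.
    rewrite {1}xE' ltn_add2l ltn_mul2l => /andP[_ lt].
    by apply: contraTT lt => xB; rewrite -leqNgt mmin // -xE'.
  have closed k : k <= x %/ s -> x - s * k \in beta la.
    elim: k => [|k IHk] lek; first by rewrite muln0 subn0.
    rewrite mulnS addnC subnDA cs ?IHk //; first exact: ltnW.
    rewrite {1}xE'; nia.
  rewrite ltnNge; apply/negP => le; case/negP: mB.
  have ms : m <= x %/ s.
    by move: le; rewrite {2}xE' leq_add2l leq_mul2l; lia.
  have -> : x %% s + s * m = x - s * (x %/ s - m) by rewrite {2}xE' mulnBr; nia.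
  exact/closed/leq_subr.
have H0 : H 0 = 0.
  apply/eqP; rewrite -leqn0 leqNgt -HB; last by rewrite mul0n.
  by apply/negP => /(allP (beta_gt0 pla)).
(* Index [s] falls back into class 0; the closed walk forces the parts to add up to [t]. *)
have Hs : H s = 0 by rewrite -[RHS]H0 /H mul0n mod0n modnMr.
have HS i : H i.+1 <= H i + t.
  rewrite leqNgt -HB; last by rewrite -modnDml Hmod modnDml mulSn addnC.
  apply/negP => /ct; rewrite leq_addl addnK => /(_ isT).
  by rewrite (HB i) ?ltnn // Hmod.
have dv i : s * ((H i + t - H i.+1) %/ s) = H i + t - H i.+1.
  rewrite mulnC divnK //; rewrite -eqn_mod_dvd //; apply/eqP.
  by rewrite -modnDml Hmod modnDml Hmod mulSn addnC.
pose w := mkseq (fun i => (H i + t - H i.+1) %/ s) s.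
have sw : size w = s by rewrite size_mkseq.
have tkE i : i <= s -> s * sumn (take i w) + H i = i * t.
  elim: i => [|i IHi] lti; first by rewrite take0 muln0 H0 mul0n.
  rewrite (take_nth 0) ?sw // -cats1 sumn_cat /= addn0 nth_mkseq // mulnDr dv.
  by have := IHi (ltnW lti); have := HS i; lia.
have gw : good s t w.
  by apply/forallP => i; rewrite -(tkE _ (ltnW (ltn_ord i))) leq_addr.
have hE i : i < s -> nheight s t w i = H i.
  by move=> lti; rewrite /nheight -(tkE _ (ltnW lti)) addKn.
exists w; split=> //.
  rewrite mem_comps sw eqxx /=.
  have := tkE s (leqnn s); rewrite Hs addn0 take_oversize ?sw // => /eqP.
  by rewrite eqn_mul2l eqn0Ngt s0.
rewrite /core_of_comp -[RHS]of_betaK; congr of_beta.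
apply: (irr_sorted_eq ltn_trans ltnn);
  rewrite ?sort_beads_sorted ?beta_sorted // => x.
rewrite mem_sort.
have [i lti xE] := modn_mulr_surj x co s0.
by rewrite (comp_beads_nheight co gw lti xE) hE // (HB i).
Qed.

Local Open Scope ring_scope.

(** * The size of a core in terms of its heights *)

Lemma big_iota0 (V : nmodType) n (F : nat -> V) :
  \sum_(i <- iota 0 n) F i = \sum_(i < n) F i.
Proof. by rewrite -(big_mkord xpredT F) /index_iota subn0. Qed.

Lemma sum_natr n : \sum_(i < n) i%:R = n%:R * (n%:R - 1) / 2 :> rat.
Proof.
elim: n => [|n IHn]; first by rewrite big_ord0 !mul0r.
by rewrite big_ord_recr /= IHn -natr1; field.
Qed.

Lemma sum_natr_sqr n :
  \sum_(i < n) i%:R ^+ 2 = n%:R * (n%:R - 1) * (2 * n%:R - 1) / 6 :> rat.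
Proof.
elim: n => [|n IHn]; first by rewrite big_ord0 !mul0r.
by rewrite big_ord_recr /= IHn -natr1; field.
Qed.

Lemma sum_sqr_diff n (h : 'I_n -> rat) :
  \sum_i \sum_j (h i - h j) ^+ 2 =
  2 * n%:R * \sum_i h i ^+ 2 - 2 * (\sum_i h i) ^+ 2.
Proof.
under eq_bigr => i _.
  have -> : \sum_j (h i - h j) ^+ 2 =
      n%:R * h i ^+ 2 + (\sum_j h j ^+ 2) + h i * (- 2 * \sum_j h j).
    rewrite -[n%:R * _](_ : \sum_(j < n) h i ^+ 2 = _); last first.
      by rewrite sumr_const card_ord mulr_natl.
    by rewrite !big_distrr -!big_split; apply: eq_bigr => j _ /=; ring.
  over.
rewrite !big_split /= -big_distrr -big_distrl sumr_const card_ord.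
by rewrite -[(\sum_(j < n) _) *+ n]mulr_natl /=; ring.
Qed.

Lemma sumn_natr (b : seq nat) : (sumn b)%:R = \sum_(x <- b) x%:R :> rat.
Proof. by rewrite sumnE natr_sum. Qed.

Lemma partition_size_of_beta b : sorted ltn b ->
  partition_size (of_beta b) =
  \sum_(x <- b) x%:R - (size b)%:R * ((size b)%:R - 1) / 2.
Proof.
move=> sb; rewrite /partition_size /of_beta sumn_rev sumn_natr big_map.
rewrite big_iota0 (big_nth 0%N) big_mkord.
rewrite -sum_natr -sumrB; apply: eq_bigr => i _.
by rewrite natrB // sorted_ltn_geq_index.
Qed.

(** Write each height as r_i + s n_i. The r_i run through all residues, so their sum and sum of
    squares are known, and both sides reduce to the sums of n_i, n_i^2 and n_i r_i. *)
Lemma partition_size_core_of_comp s t w : coprime s t -> (0 < s)%N ->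
  good s t w -> partition_size (core_of_comp s t w) = comp_size s t w.
Proof.
move=> co s0 gw; rewrite partition_size_of_beta ?sort_beads_sorted //.
rewrite size_sort (perm_big (comp_beads s t w)) /=; last by rewrite perm_sort.
pose r (i : 'I_s) : rat := (nheight s t w i %% s)%:R.
pose n (i : 'I_s) : rat := (nheight s t w i %/ s)%:R.
have hE (i : 'I_s) : height s t w i = r i + s%:R * n i.
  rewrite /height -(nheightK gw (ltn_ord i)) natrD addrK.
  by rewrite {1}(divn_eq (nheight s t w i) s) natrD natrM mulrC addrC.
have rF (F : rat -> rat) : \sum_i F (r i) = \sum_(i < s) F i%:R.
  rewrite [RHS](reindex_inj (@modn_mulr_ord_inj s t s0 co)) /=.
  by apply: eq_bigr => i _; rewrite /r nheight_mod.
have r1 := rF id; have r2 := rF (fun x => x ^+ 2).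
rewrite /= sum_natr in r1; rewrite /= sum_natr_sqr in r2.
have -> : (size (comp_beads s t w))%:R = \sum_i n i.
  rewrite size_allpairs_dep sumnE big_map.
  rewrite (big_iota0 _ (fun i => size (iota 0 (nheight s t w i %/ s)))).
  rewrite natr_sum.
  by apply: eq_bigr => i _; rewrite size_iota.
have -> : \sum_(x <- comp_beads s t w) x%:R =
    \sum_i (n i * r i) + s%:R / 2 * (\sum_i n i ^+ 2 - \sum_i n i).
  rewrite big_allpairs_dep big_iota0 -sumrB big_distrr -big_split.
  apply: eq_bigr => i _ /=.
  set m := (_ %/ _)%N; rewrite big_iota0.
  under eq_bigr => j _ do rewrite natrD natrM.
  rewrite big_split /= -big_distrr sumr_const card_ord -mulr_natl /=.
  by rewrite sum_natr /n /r -/m; field.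
have h1 : \sum_(i < s) height s t w i =
    s%:R * (s%:R - 1) / 2 + s%:R * \sum_i n i.
  by rewrite -r1 big_distrr -big_split; apply: eq_bigr => i _; rewrite hE.
have h2 : \sum_(i < s) height s t w i ^+ 2 =
    s%:R * (s%:R - 1) * (2 * s%:R - 1) / 6 +
    2 * s%:R * \sum_i (n i * r i) + s%:R ^+ 2 * \sum_i n i ^+ 2.
  rewrite -r2 !big_distrr -!big_split; apply: eq_bigr => i _.
  by rewrite hE /=; ring.
have sn0 : s%:R != 0 :> rat by rewrite pnatr_eq0 -lt0n.
by rewrite /comp_size sum_sqr_diff h1 h2; field.
Qed.

Lemma size_comps s t : (0 < s)%N -> size (comps s t) = 'C(t + s.-1, s.-1).
Proof.
case: s => // n _; have := sum_binw n (fun _ => 0%N) t.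
rewrite sum_nat_const muln0 addn0 /= => <-; rewrite -sum1_size.
by apply: eq_bigr => w _; rewrite /binw big1 // => i _; rewrite bin0.
Qed.

Lemma uniform_E_cores s t (g : rat -> rat) :
  coprime s t -> (0 < s)%N -> (0 < t)%N ->
  uniform_E (st_cores s t) (fun la => g (partition_size la)) =
  (\sum_(w <- comps s t) g (comp_size s t w)) / 'C(t + s.-1, s.-1)%:R.
Proof.
move=> co s0 t0.
pose L := [seq core_of_comp s t w | w <- comps s t & good s t w].
have memF w : w \in [seq w <- comps s t | good s t w] ->
    w \in comps s t /\ good s t w.
  by rewrite mem_filter => /andP[].
have uL : uniq L.
  rewrite map_inj_in_uniq ?filter_uniq ?comps_uniq //.
  by move=> w w' /memF[wC gw] /memF[wC' gw']; apply: core_of_comp_inj.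
have EL : st_cores s t = [set` L]%classic.
  apply/seteqP; split=> la /=.
    move=> /(core_of_comp_surj co s0 t0)[w [wC gw <-]].
    by rewrite map_f // mem_filter gw.
  by move=> /mapP[w /memF[wC gw] ->]; apply: core_of_comp_core.
have sum_L h : \sum_(la <- L) h (partition_size la) =
    \sum_(w <- comps s t | good s t w) h (comp_size s t w) :> rat.
  rewrite big_map big_filter big_seq_cond [RHS]big_seq_cond.
  by apply: eq_bigr => w /andP[_ gw]; rewrite partition_size_core_of_comp.
rewrite /uniform_E EL -fsbig_seq // sum_L.
have -> : #|` fset_set [set` L]%classic| = size L.
  apply/perm_size/uniq_perm => // la.
  rewrite in_fset_set; last exact: finite_seq.
  by apply/idP/idP => [/set_mem|/mem_set].
have cL : 'C(t + s.-1, s.-1)%:R = s%:R * (size L)%:R :> rat.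
  rewrite -size_comps // -!sum1_size !natr_sum.
  by rewrite (sum_comps_good (fun _ => 1)) // -(sum_L (fun _ => 1)).
have sn0 : s%:R != 0 :> rat by rewrite pnatr_eq0 -lt0n.
by rewrite cL sum_comps_good // invfM mulrACA mulfV // mul1r.
Qed.

(** * Interpolation *)

(** Averaging over all compositions keeps this meaningful, and polynomial in [t], even when [t] is
    not coprime to [s]. *)
Definition central_avg (k s t : nat) : rat :=
  (\sum_(w <- comps s t) (comp_size s t w - mean_size s t) ^+ k)
    / 'C(t + s.-1, s.-1)%:R.

Lemma natr_bin_neq0 s t : 'C(t + s.-1, s.-1)%:R != 0 :> rat.
Proof. by rewrite pnatr_eq0 -lt0n bin_gt0 leq_addl. Qed.

Lemma central_avg_poly k s : (0 < s)%N ->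
  exists2 p : {poly rat}, (size p <= k.*2.+1)%N &
    forall t, central_avg k s t = p.[t%:R] /\ p.[- (s + t)%:R] = p.[t%:R].
Proof.
case: s => // n _; have [p sp pE] := central_sum_poly n k; exists p => // t.
have [e1 e2] := pE t; split=> //.
by rewrite /central_avg e1 mulrC mulKf // natr_bin_neq0.
Qed.

Lemma mean_sizeC s t : mean_size s t = mean_size t s.
Proof. by rewrite /mean_size; ring. Qed.

Lemma st_coresC s t : st_cores s t = st_cores t s.
Proof. by apply/seteqP; split=> la [pla [? ?]]. Qed.

Lemma uniform_E_central k s t : coprime s t -> (0 < s)%N -> (0 < t)%N ->
  uniform_E (st_cores s t)
    (fun la => (partition_size la - mean_size s t) ^+ k) =
  central_avg k s t.
Proof.
move=> co s0 t0.
by rewrite (uniform_E_cores (fun x => (x - mean_size s t) ^+ k)).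
Qed.

Lemma central_avgC k s t : coprime s t -> (0 < s)%N -> (0 < t)%N ->
  central_avg k s t = central_avg k t s.
Proof.
move=> co s0 t0; rewrite -!uniform_E_central // 1?coprime_sym //.
by rewrite st_coresC mean_sizeC.
Qed.

Lemma coprime_subr s d : (d <= s)%N -> coprime s d -> coprime s (s - d).
Proof.
move/subnK=> <-; rewrite addnK; move: (s - d)%N => e.
by rewrite /coprime gcdnC gcdnDr gcdnC [in X in _ -> X]gcdnC gcdnDl.
Qed.

Lemma coprimen4 n : coprime n 4 = odd n.
Proof. by rewrite -[4%N]/(2 ^ 2)%N coprime_pexpr // coprimen2. Qed.

(** The [s] with fewer than six smaller coprime numbers, together with 7, for which the choice 1, 2,
    4 does not stay below s / 2. *)
Definition sporadic : seq nat := [:: 1; 2; 3; 4; 5; 6; 7; 8; 10; 12]%N.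

(** Three coprime numbers below s / 2 and their complements suffice: 1, 2, 4 for odd s; 1, m - 4, m
    - 2 for s = 2m with m odd; 1, 2k - 1 and k - 2 or k - 1, for k odd or even, when s = 4k. *)
Lemma six_coprimes s : (0 < s)%N -> s \notin sporadic ->
  exists ts : seq nat, [/\ uniq ts, size ts = 6 &
    {in ts, forall t, [/\ (0 < t)%N, (t < s)%N & coprime s t]}].
Proof.
move=> s0 ns.
suff [d1 [d2 [d3 [[h1 h2 h3 h4] [c1 c2 c3]]]]] : exists d1 d2 d3 : nat,
    [/\ 0 < d1, d1 < d2, d2 < d3 & d3.*2 < s]%N /\
    [/\ coprime s d1, coprime s d2 & coprime s d3].
  exists [:: d1; d2; d3; s - d3; s - d2; s - d1]%N; split=> //.
    by rewrite /= !inE; lia.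
  move=> t; rewrite !inE.
  move=> /or4P[/eqP->|/eqP->|/eqP->|/or3P[]/eqP->];
    split=> //; try lia; by apply: coprime_subr => //; lia.
rewrite !inE in ns; have le9 : (9 <= s)%N by lia.
case sodd : (odd s).
  exists 1, 2, 4; split; first by split; lia.
  by split; rewrite ?coprimen1 ?coprimen2 ?coprimen4.
have [m sE] : exists m, s = m.*2.
  by exists s./2; rewrite -[LHS]odd_double_half sodd.
case modd : (odd m).
  have m7 : (7 <= m)%N by have := odd_double_half m; rewrite modd; lia.
  have cm d : odd (m - d) -> (d <= m)%N -> coprime m d -> coprime s (m - d).
    by move=> od dm cd; rewrite sE -muln2 coprimeMl coprime2n od coprime_subr.
  exists 1, (m - 4)%N, (m - 2)%N; split; first by split; lia.
  split; first exact: coprimen1.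
    apply: cm; [by rewrite oddB ?modd //; lia | lia |].
    by rewrite coprimen4.
  by apply: cm; [by rewrite oddB ?modd //; lia | lia | rewrite coprimen2].
have [k mE] : exists k, m = k.*2.
  by exists m./2; rewrite -[LHS]odd_double_half modd.
have k4 : (4 <= k)%N by lia.
have c3 : coprime s (k.*2.-1).
  rewrite sE mE -muln2 coprimeMl coprime2n -subn1.
  rewrite coprime_subr ?coprimen1 //; last by lia.
  by rewrite oddB ?odd_double //; lia.
have c4 d : odd d -> coprime s d = coprime k d.
  by move=> od; rewrite sE mE -!muln2 !coprimeMl !coprime2n od !andbT.
case kodd : (odd k).
  exists 1, (k - 2)%N, k.*2.-1; split; first by split; lia.
  split; rewrite ?coprimen1 //.
  rewrite c4; last by rewrite oddB ?kodd //; lia.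
  by apply: coprime_subr; [lia | rewrite coprimen2].
exists 1, (k - 1)%N, k.*2.-1; split; first by split; lia.
split; rewrite ?coprimen1 //.
rewrite c4; last by rewrite oddB ?kodd //; lia.
by apply: coprime_subr; [lia | rewrite coprimen1].
Qed.

(** The six points and their negative reflections are twelve distinct roots of p - q, whose degree
    is at most 10. *)
Lemma eq_poly_reflect (s : nat) (ts : seq nat) (p q : {poly rat}) :
  (0 < s)%N -> uniq ts -> size ts = 6 ->
  (size p <= 11)%N -> (size q <= 11)%N ->
  {in ts, forall t, p.[t%:R] = q.[t%:R]} ->
  (forall t : nat, p.[- (s + t)%:R] = p.[t%:R]) ->
  (forall t : nat, q.[- (s + t)%:R] = q.[t%:R]) -> p = q.
Proof.
move=> s0 uts sts sp sq e rp rq; apply/eqP; rewrite -subr_eq0; apply/eqP.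
pose rs : seq rat :=
  [seq t%:R | t : nat <- ts] ++ [seq - (s + t)%:R | t : nat <- ts].
apply: (@roots_geq_poly_eq0 _ _ rs).
- rewrite all_cat !all_map; apply/andP; split; apply/allP => t tts /=;
    by rewrite rootE hornerD hornerN ?rp ?rq e // subrr.
- rewrite cat_uniq !map_inj_uniq // ?uts /=.
  + rewrite andbT; apply/hasPn => _ /mapP[t _ ->].
    apply/negP => /mapP[t' _ /eqP].
    by rewrite eq_sym -subr_eq0 opprK -natrD pnatr_eq0; lia.
  + by move=> t t' /oppr_inj/eqP; rewrite eqr_nat eqn_add2l => /eqP.
  + by move=> t t' /eqP; rewrite eqr_nat => /eqP.
rewrite size_cat !size_map sts (leq_trans (size_polyD _ _)) //.
by rewrite size_polyN geq_max (leqW sp) (leqW sq).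
Qed.

(** The candidate [q] is left general so that one induction serves both the mean and the fifth
    moment. *)
Lemma central_avg_eq k (q : nat -> {poly rat}) : (k <= 5)%N ->
  (forall s, size (q s) <= 11)%N ->
  (forall s t : nat, (q s).[- (s + t)%:R] = (q s).[t%:R]) ->
  (forall s t : nat, (q s).[t%:R] = (q t).[s%:R]) ->
  (forall s t, s \in sporadic -> (t < 6)%N ->
    central_avg k s t = (q s).[t%:R]) ->
  forall s t, coprime s t -> (0 < s)%N -> (0 < t)%N ->
  central_avg k s t = (q s).[t%:R].
Proof.
move=> k5 sq rq symq base s; elim/ltn_ind: s => s IHs t co s0 t0.
have [p sp pE] := central_avg_poly k s0.
have [ts [uts sts tsE]] : exists ts : seq nat, [/\ uniq ts, size ts = 6 &
    {in ts, forall t', central_avg k s t' = (q s).[t'%:R]}].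
  case: (boolP (s \in sporadic)) => sS.
    exists (iota 0 6); split; rewrite ?iota_uniq ?size_iota // => t'.
    by rewrite mem_iota => lt; apply: base.
  have [ts [uts sts tsP]] := six_coprimes s0 sS.
  exists ts; split=> // t' /tsP[t'0 lt co'].
  (* Exchanging the arguments puts the smaller number [t'] first, where the induction hypothesis
     applies. *)
  by rewrite central_avgC // symq IHs // coprime_sym.
rewrite (proj1 (pE t)); congr (_.[_]).
apply: (eq_poly_reflect s0 uts sts) => //.
- by rewrite (leq_trans sp) // ltnS -[10%N]/(5.*2)%N leq_double.
- by move=> t' /tsE <-; rewrite (proj1 (pE t')).
- by move=> t'; rewrite (proj2 (pE t')).
Qed.

(** * The fifth moment *)

(* Coefficients of [P5 s] in its second argument. The numerals go through [c] so
   that they stay binary when the polynomial is evaluated in [Z]. *)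
Definition P5_coefs (R : comNzRingType) (c : nat -> R) (s : R) : seq R :=
  [:: - c 180 * s ^+ 6 - c 180 * s ^+ 4 - c 180 * s ^+ 2 - c 3780;
      c 333 * s ^+ 6 - c 540 * s ^+ 5 + c 420 * s ^+ 4 - c 360 * s ^+ 3
        + c 327 * s ^+ 2 - c 180 * s;
      - c 211 * s ^+ 6 + c 999 * s ^+ 5 - c 1283 * s ^+ 4 + c 840 * s ^+ 3
        - c 540 * s ^+ 2 + c 327 * s - c 180;
      c 46 * s ^+ 6 - c 633 * s ^+ 5 + c 1665 * s ^+ 4 - c 1666 * s ^+ 3
        + c 840 * s ^+ 2 - c 360 * s;
      c 138 * s ^+ 5 - c 844 * s ^+ 4 + c 1665 * s ^+ 3 - c 1283 * s ^+ 2
        + c 420 * s - c 180;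
      c 138 * s ^+ 4 - c 633 * s ^+ 3 + c 999 * s ^+ 2 - c 540 * s;
      c 46 * s ^+ 3 - c 211 * s ^+ 2 + c 333 * s - c 180].

Lemma P5E s t : P5 s t = horner_rec (P5_coefs (fun n => n%:R) s) t.
Proof. by rewrite /P5 /=; ring. Qed.

Definition moment5_num (s t : rat) : rat :=
  s * t * (t - 1) * (s - 1) * (s + t + 1) * (s + t) * P5 s t.

Lemma mulr_moment5_num c s t : c * moment5_num s t =
  c * s * t * (t - 1) * (s - 1) * (s + t + 1) * (s + t) * P5 s t.
Proof. by rewrite /moment5_num; move: (P5 s t) => P; rewrite !mulrA. Qed.

Lemma moment5_numC s t : moment5_num s t = moment5_num t s.
Proof. by rewrite /moment5_num /P5; ring. Qed.

Lemma moment5_num_reflect s t : moment5_num s (- (s + t)) = moment5_num s t.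
Proof. by rewrite /moment5_num /P5; ring. Qed.

Definition moment5_poly (c s : rat) : {poly rat} :=
  (c * (s * (s - 1))) *:
    ('X * ('X - 1%:P) * ('X + (s + 1)%:P) * ('X + s%:P)
      * Poly (P5_coefs (fun n => n%:R) s)).

Lemma size_moment5_poly c s : (size (moment5_poly c s) <= 11)%N.
Proof.
rewrite (leq_trans (size_scale_leq _ _)) //.
have sM (p q : {poly rat}) m n : (size p <= m.+1)%N -> (size q <= n)%N ->
    (size (p * q)%R <= m + n)%N.
  by move=> sp sq; rewrite (leq_trans (size_polyMleq _ _)) //; lia.
have s2 x : (size (('X + x%:P)%R : {poly rat}) <= 2)%N by rewrite size_XaddC.
apply: (sM _ _ 4 7); last exact: size_Poly.
apply: (sM _ _ 3 2); last exact: s2.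
apply: (sM _ _ 2 2); last exact: s2.
by apply: (sM _ _ 1 2); rewrite ?size_polyX // size_XsubC.
Qed.

Lemma horner_moment5_poly c s t : (moment5_poly c s).[t] = c * moment5_num s t.
Proof.
rewrite /moment5_poly !(hornerZ, hornerM, hornerD, hornerN, hornerX, hornerC).
by rewrite horner_Poly -P5E /moment5_num; move: (P5 s t) => P; ring.
Qed.

(** * Checking the small cases in binary integers *)

Fixpoint zheights (s t u : Z) (w : seq nat) : seq Z :=
  if w is z :: w' then u :: zheights s t (u + t - s * Z.of_nat z) w' else [::].

(* 24 s^2 (comp_size - mean_size) is an integer. *)
Definition zdev (s t : Z) (w : seq nat) : Z :=
  let h := zheights s t 0 w in
  Z.of_nat 12 * (s * foldr (fun x y => x * x + y) 0 h - foldr +%R 0 h ^+ 2)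
  - s ^+ 2 * ((s ^+ 2 - 1) + (s - 1) * (t - 1) * (s + t + 1)).

(** The formulas for the first and fifth moments with denominators cleared: each deviation carries
    24 s^2, and [size l] is the number of compositions. *)
Definition zcheck (s t : nat) : bool :=
  let S := Z.of_nat s in let T := Z.of_nat t in
  let l := [seq zdev S T w | w <- comps s t] in
  (foldr +%R 0 l == 0) &&
  ((Z.of_nat 958 * Z.of_nat 10 ^+ 5 + Z.of_nat 320)
     * foldr (fun x y => x ^+ 5 + y) 0 l ==
   (Z.of_nat 24 * S ^+ 2) ^+ 5 * Z.of_nat (size l) *
   (S * T * (T - 1) * (S - 1) * (S + T + 1) * (S + T) *
     horner_rec (P5_coefs Z.of_nat S) T)).

Lemma zcheck_sporadic : all (fun s => all (zcheck s) (iota 0 6)) sporadic.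
Proof. by vm_compute. Qed.

Definition ratZ (z : Z) : rat := (int_of_Z z)%:~R.

Lemma ratZD : {morph ratZ : x y / x + y}.
Proof. by move=> x y; rewrite /ratZ !rmorphD. Qed.

Lemma ratZB : {morph ratZ : x y / x - y}.
Proof. by move=> x y; rewrite /ratZ !rmorphB. Qed.

Lemma ratZN : {morph ratZ : x / - x}.
Proof. by move=> x; rewrite /ratZ !rmorphN. Qed.

Lemma ratZM : {morph ratZ : x y / x * y}.
Proof. by move=> x y; rewrite /ratZ !rmorphM. Qed.

Lemma ratZX n : {morph ratZ : x / x ^+ n}.
Proof. by move=> x; rewrite /ratZ !rmorphXn. Qed.

Lemma ratZn n : ratZ n%:R = n%:R.
Proof. by rewrite /ratZ !rmorph_nat. Qed.

Lemma ratZ0 : ratZ 0 = 0. Proof. by []. Qed.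

Lemma ratZ1 : ratZ 1 = 1. Proof. by []. Qed.

Definition ratZE := (ratZB, ratZD, ratZN, ratZM, ratZX, ratZ0, ratZ1, ratZn).

Lemma ratZ_nat n : ratZ (Z.of_nat n) = n%:R.
Proof. by rewrite /ratZ (_ : int_of_Z (Z.of_nat n) = n) //; lia. Qed.

Lemma ratZ_foldr (F : Z -> Z) (l : seq Z) :
  ratZ (foldr (fun x y => F x + y) 0 l) = \sum_(x <- l) ratZ (F x).
Proof.
elim: l => [|x l IHl]; first by rewrite big_nil ratZE.
by rewrite big_cons -IHl -ratZD.
Qed.

Lemma sum_zheights (F : rat -> rat) s t u w :
  \sum_(x <- zheights (Z.of_nat s) (Z.of_nat t) u w) F (ratZ x) =
  \sum_(i < size w) F (ratZ u + height s t w i).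
Proof.
elim: w u => [|z w IHw] u /=; first by rewrite big_nil big_ord0.
rewrite big_cons big_ord_recl IHw /=; congr (_ + _).
  by rewrite /height mul0n muln0 subrr addr0.
apply: eq_bigr => i _; congr F; rewrite /bump /=.
have -> : ratZ (u + Z.of_nat t - Z.of_nat s * Z.of_nat z) =
    ratZ u + t%:R - s%:R * z%:R.
  by rewrite !ratZE !ratZ_nat.
by rewrite /height /= !natrM !natrD; ring.
Qed.

Lemma ratZ_zdev s t w : (0 < s)%N -> w \in comps s t ->
  ratZ (zdev (Z.of_nat s) (Z.of_nat t) w) =
  24 * s%:R ^+ 2 * (comp_size s t w - mean_size s t).
Proof.
move=> s0; rewrite mem_comps => /andP[/eqP sw _].
have sn0 : s%:R != 0 :> rat by rewrite pnatr_eq0 -lt0n.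
rewrite /zdev; set h := zheights _ _ _ _.
have h1 : ratZ (foldr +%R 0 h) = \sum_(i < s) height s t w i.
  rewrite (ratZ_foldr id) (sum_zheights id) sw.
  by apply: eq_bigr => i _; rewrite ratZE add0r.
have h2 : ratZ (foldr (fun x y => x * x + y) 0 h) =
    \sum_(i < s) height s t w i ^+ 2.
  rewrite (ratZ_foldr (fun x => x * x)).
  under eq_bigr do rewrite ratZM -expr2.
  rewrite (sum_zheights (fun x => x ^+ 2)) sw.
  by apply: eq_bigr => i _; rewrite ratZE add0r.
rewrite !ratZE h1 h2 !ratZ_nat.
by rewrite /comp_size /mean_size sum_sqr_diff; field.
Qed.

Lemma ratZ_horner_rec l x :
  ratZ (horner_rec l x) = horner_rec [seq ratZ c | c <- l] (ratZ x).
Proof. by elim: l => //= c l IHl; rewrite ratZD ratZM IHl. Qed.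

Lemma ratZ_P5_coefs (c : nat -> Z) (c' : nat -> rat) s :
  (forall n, ratZ (c n) = c' n) ->
  [seq ratZ x | x <- P5_coefs c s] = P5_coefs c' (ratZ s).
Proof.
move=> cE; congr [:: _; _; _; _; _; _; _];
  by rewrite !(ratZB, ratZD, ratZN, ratZM, ratZX) !cE.
Qed.

Lemma ratZ_P5 s t :
  ratZ (horner_rec (P5_coefs Z.of_nat (Z.of_nat s)) (Z.of_nat t)) =
  P5 s%:R t%:R.
Proof. by rewrite ratZ_horner_rec (ratZ_P5_coefs _ ratZ_nat) !ratZ_nat P5E. Qed.

Definition moment5_coef : rat := 1 / (958 * 10 ^+ 5 + 320).

(** Stated for variables so that [ratZ] is distributed without unfolding the numerals or the value
    of [P5]. *)
Lemma ratZ_zcheck (a b c d n s t p x : Z) :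
  (a * b ^+ 5 + c) * x =
    (d * s ^+ 2) ^+ 5 * n *
    (s * t * (t - 1) * (s - 1) * (s + t + 1) * (s + t) * p) ->
  (ratZ a * ratZ b ^+ 5 + ratZ c) * ratZ x =
    (ratZ d * ratZ s ^+ 2) ^+ 5 * ratZ n *
    (ratZ s * ratZ t * (ratZ t - 1) * (ratZ s - 1) * (ratZ s + ratZ t + 1)
      * (ratZ s + ratZ t) * ratZ p).
Proof. by move/(congr1 ratZ); rewrite !ratZE. Qed.

Lemma zcheck_solve (K A C M S : rat) : K != 0 -> A != 0 -> C != 0 ->
  K * (A * S) = A * C * M -> S / C = 1 / K * M.
Proof.
move=> K0 A0 C0 e; apply: (mulfI A0); apply: (mulfI K0).
by rewrite [A * (S / C)]mulrA [K * (_ / C)]mulrA e; field; rewrite C0 K0.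
Qed.

Lemma zcheckP s t : (0 < s)%N -> zcheck s t ->
  central_avg 1 s t = 0 /\
  central_avg 5 s t = moment5_coef * moment5_num s%:R t%:R.
Proof.
move=> s0.
have sn0 : s%:R != 0 :> rat by rewrite pnatr_eq0 -lt0n.
have A0 : 24 * s%:R ^+ 2 != 0 :> rat by rewrite mulf_neq0 // expf_neq0.
have d1 : \sum_(w <- comps s t) ratZ (zdev (Z.of_nat s) (Z.of_nat t) w) =
    24 * s%:R ^+ 2 * \sum_(w <- comps s t) (comp_size s t w - mean_size s t).
  by rewrite big_distrr !big_seq; apply: eq_bigr => w wC; rewrite ratZ_zdev.
have d5 : \sum_(w <- comps s t) ratZ (zdev (Z.of_nat s) (Z.of_nat t) w ^+ 5) =
    (24 * s%:R ^+ 2) ^+ 5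
      * \sum_(w <- comps s t) (comp_size s t w - mean_size s t) ^+ 5.
  rewrite big_distrr !big_seq; apply: eq_bigr => w wC.
  by rewrite ratZX ratZ_zdev // exprMn.
have K0 : 958 * 10 ^+ 5 + 320 != 0 :> rat.
  apply: lt0r_neq0; apply: addr_gt0; last by rewrite ltr0n.
  by apply: mulr_gt0; last apply: exprn_gt0; rewrite ltr0n.
have C0 := natr_bin_neq0 s t.
case/andP=> /eqP/(congr1 ratZ) e1 /eqP/ratZ_zcheck e5.
rewrite (ratZ_foldr id) big_map d1 ratZ0 in e1.
rewrite (ratZ_foldr (fun x => x ^+ 5)) big_map d5 in e5.
rewrite size_map (size_comps _ s0) in e5.
rewrite ratZ_P5 in e5.
rewrite (ratZ_nat 958) (ratZ_nat 10) (ratZ_nat 320) (ratZ_nat 24) in e5.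
rewrite !(ratZ_nat s) !(ratZ_nat t) ratZ_nat in e5.
split.
  move/eqP: e1; rewrite mulf_eq0 (negPf A0) /= => /eqP e1.
  by rewrite /central_avg; under eq_bigr do rewrite expr1; rewrite e1 mul0r.
exact: zcheck_solve K0 (expf_neq0 5 A0) C0 e5.
Qed.

Lemma central_avg_sporadic s t : s \in sporadic -> (t < 6)%N ->
  central_avg 1 s t = 0 /\
  central_avg 5 s t = moment5_coef * moment5_num s%:R t%:R.
Proof.
move=> sS lt; have tI : t \in iota 0 6 by rewrite mem_iota.
have s0 : (0 < s)%N by move: sS; case: s.
exact: zcheckP s0 (allP (allP zcheck_sporadic s sS) t tI).
Qed.

(** * The mean and the fifth central moment *)

Lemma central_avg1 s t : coprime s t -> (0 < s)%N -> (0 < t)%N ->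
  central_avg 1 s t = 0.
Proof.
move=> co s0 t0; rewrite (@central_avg_eq 1 (fun _ => 0)) ?horner0 //.
- by move=> *; rewrite size_poly0.
- by move=> *; rewrite !horner0.
- by move=> *; rewrite !horner0.
move=> s' t' sS lt; rewrite horner0.
exact: proj1 (central_avg_sporadic sS lt).
Qed.

Lemma central_avg5 s t : coprime s t -> (0 < s)%N -> (0 < t)%N ->
  central_avg 5 s t = moment5_coef * moment5_num s%:R t%:R.
Proof.
move=> co s0 t0; rewrite -horner_moment5_poly.
pose q (s' : nat) := moment5_poly moment5_coef s'%:R.
apply: (@central_avg_eq 5 q) co s0 t0 => //; rewrite /q.
- by move=> s'; exact: size_moment5_poly.
- by move=> s' t'; rewrite !horner_moment5_poly natrD moment5_num_reflect.
- by move=> s' t'; rewrite !horner_moment5_poly moment5_numC.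
move=> s' t' sS lt; rewrite horner_moment5_poly.
exact: proj2 (central_avg_sporadic sS lt).
Qed.

(** The first moment about [mean_size] vanishes, so moments about [mean_size] are moments about the
    mean. *)
Lemma uniform_E_partition_size s t : coprime s t -> (0 < s)%N -> (0 < t)%N ->
  uniform_E (st_cores s t) partition_size = mean_size s t.
Proof.
move=> co s0 t0; rewrite (uniform_E_cores id) //.
have C0 := natr_bin_neq0 s t.
have /eqP := central_avg1 co s0 t0.
rewrite /central_avg mulf_eq0 invr_eq0 (negPf C0) orbF sumrB subr_eq0.
move=> /eqP ->.
have S1 : \sum_(w <- comps s t) 1 = 'C(t + s.-1, s.-1)%:R :> rat.
  by rewrite -size_comps // -sum1_size natr_sum.
by rewrite -[mean_size s t in LHS]mulr1 -big_distrr S1 /= mulfK.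
Qed.

(* 958 * 10 ^+ 5 + 320 is 95800320: a single literal of that size would be
   parsed through a unary natural number and overflow the stack. *)
Theorem theorem5 (s t : nat) (s_gt0 : (0 < s)%N) (t_gt0 : (0 < t)%N)
    (co_st : coprime s t) :
  let sq : rat := s%:R in
  let tq : rat := t%:R in
  moment_about_mean (st_cores s t) partition_size 5 =
  1 / (958 * 10 ^+ 5 + 320)
    * sq * tq * (tq - 1) * (sq - 1) * (sq + tq + 1) * (sq + tq) * P5 sq tq.
Proof.
move=> sq tq.
rewrite /moment_about_mean (uniform_E_partition_size co_st s_gt0 t_gt0).
rewrite (uniform_E_central 5 co_st s_gt0 t_gt0).
rewrite (central_avg5 co_st s_gt0 t_gt0).
exact: (mulr_moment5_num moment5_coef).
Qed.
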